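(* Let $X$ and $Y$ be Banach spaces and let $T\in L(X)$, $C\in L(X,Y)$, $B\in L(Y,X)$ be such that $C$ is surjective, $B$ is injective and $T=BC$. Suppose that the Moore-Penrose inverse $T^{\dag}$ exists. Then the following statements are equivalent: (i) $T$ is an EP operator; (ii) there exists an isomorphism $U\in L(Y)$ such that $C=UB^{\dag}$; (iii) there exists an injective map $U_1\in L(Y)$ such that $C=U_1B^{\dag}$; (iv) there exist $U_2,U_3\in L(Y)$ such that $C=U_2B^{\dag}$ and $B^{\dag}=U_3C$; (v) there exists an isomorphism $W\in L(Y)$ such that $B=C^{\dag}W$; (vi) there exists a surjective map $W_1\in L(Y)$ such that $B=C^{\dag}W_1$; (vii) there exist $W_2,W_3\in L(Y)$ such that $B=C^{\dag}W_2$ and $C^{\dag}=BW_3$; (viii) there exist $H_1,H_2\in L(Y)$ such that $B=C^{\dag}H_2$ and $C=H_1B^{\dag}$; (ix) there exist $K_1,K_2\in L(Y)$ such that $C^{\dag}=BK_2$ and $B^{\dag}=K_1C$; (x) there exists an injective map $S_1\in L(Y)$ such that $B^{\dag}=S_1C$; (xi) there exists a surjective map $S_2\in L(Y)$ such that $C^{\dag}=BS_2$.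
   Context: Banach spaces are complex; $L(X,Y)$ is the space of bounded linear maps $X\to Y$, $L(X)=L(X,X)$. An isomorphism in $L(Y)$ is a bijective bounded linear map. An operator $S\in L(X)$ is hermitian if $\|\exp(itS)\|=1$ for all $t\in\mathbb{R}$ (on the zero space, the unique operator is regarded as hermitian). An operator $T\in L(X,Y)$ is Moore-Penrose invertible if there is $S\in L(Y,X)$ with $T=TST$, $S=STS$, and $ST\in L(X)$, $TS\in L(Y)$ hermitian; such $S$ is unique and is denoted $T^{\dag}$. An operator $T\in L(X)$ is EP if $T^{\dag}$ exists and $TT^{\dag}=T^{\dag}T$. Under the hypotheses of the claim the Moore-Penrose inverses $B^{\dag}\in L(X,Y)$ and $C^{\dag}\in L(Y,X)$ exist. *)

(* Defs.v *)
From HB Require Import structures.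
From mathcomp Require Import all_boot all_order all_algebra.
From mathcomp Require Import complex.
From mathcomp Require Import all_classical all_reals all_analysis.

Set Implicit Arguments.
Unset Strict Implicit.
Unset Printing Implicit Defensive.
Import Order.TTheory GRing.Theory Num.Theory.
Import numFieldNormedType.Exports.
Local Open Scope classical_set_scope.
Local Open Scope complex_scope.
Local Open Scope ring_scope.

Section BoundedLinearMaps.
Context {R : realType} {X Y : normedModType R[i]}.

Definition bounded_linear_pred : {pred X -> Y} := fun f =>
  `[< linear f /\ exists M : R[i], forall x, `|f x| <= M * `|x| >].

Lemma bounded_linear_submod : submod_closed bounded_linear_pred.
Proof.
split.
  apply/asboolP; split; first by move=> a u v /=; rewrite /GRing.zero/= scaler0 addr0.
  by exists 0 => x; rewrite normr0 mul0r.
move=> a f g /asboolP[lf [M hM]] /asboolP[lg [N hN]]; apply/asboolP; split.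
  move=> b u v.
  have -> : forall w, (a *: f + g) w = a *: f w + g w by [].
  rewrite lf lg !scalerDr !scalerA (mulrC b a) -!addrA; congr (_ + _).
  by rewrite addrCA.
exists (`|a| * M + N) => x.
have -> : (a *: f + g) x = a *: f x + g x by [].
rewrite (le_trans (ler_normD _ _))// mulrDl lerD// normrZ -mulrA.
by rewrite ler_wpM2l.
Qed.

HB.instance Definition _ :=
  GRing.isSubmodClosed.Build _ _ bounded_linear_pred bounded_linear_submod.

End BoundedLinearMaps.

Record blin (R : realType) (X Y : normedModType R[i]) := BLin {
  blin_fun :> X -> Y;
  blin_prop : blin_fun \in bounded_linear_pred }.

Notation "''L' ( X , Y )" := (blin X Y)
  (at level 8, X at level 99, Y at level 99, format "''L' ( X ,  Y )").
Notation "''L' ( X )" := (blin X X)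
  (at level 8, X at level 99, format "''L' ( X )").

Section BlinLmodule.
Context {R : realType} {X Y : normedModType R[i]}.
HB.instance Definition _ := [isSub of 'L(X, Y) for @blin_fun R X Y].
HB.instance Definition _ := [Choice of 'L(X, Y) by <:].
HB.instance Definition _ := [SubChoice_isSubLmodule of 'L(X, Y) by <:].


Lemma blin_linear (f : 'L(X, Y)) : linear f.
Proof. by have /asboolP[] := blin_prop f. Qed.

HB.instance Definition _ (f : 'L(X, Y)) :=
  GRing.isLinear.Build _ _ _ _ (blin_fun f) (blin_linear f).

Lemma blin_bounded (f : 'L(X, Y)) :
  exists M : R[i], forall x, `|f x| <= M * `|x|.
Proof. by have /asboolP[] := blin_prop f. Qed.

(* The norm of a normedModType over R[i] takes its values in R[i]; the supremum
   is taken in R. *)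
Definition opnorm (f : 'L(X, Y)) : R :=
  sup [set complex.Re `|f x| | x in [set x | `|x| <= 1]].

Lemma Re_normK (V : normedModType R[i]) (v : V) : (complex.Re `|v|)%:C = `|v|.
Proof. by apply: RRe_real; apply: normr_real. Qed.

Lemma opnorm_has_sup (f : 'L(X, Y)) :
  has_sup [set complex.Re `|f x| | x in [set x | `|x| <= 1]].
Proof.
split; first by exists (complex.Re `|f 0|); exists 0 => //=; rewrite normr0.
have [M hM] := blin_bounded f.
exists (complex.Re `|M|) => _ [x /= x1 <-].
rewrite -lecR !Re_normK; have M0 : 0 <= M * `|x| by apply: le_trans (hM x).
rewrite (le_trans (hM x))// -(ger0_norm M0) normrM normr_id.
by rewrite ler_piMr ?normr_ge0 ?normr_id.
Qed.

Lemma opnorm_ge0 (f : 'L(X, Y)) : 0 <= opnorm f.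
Proof.
apply: le_trans (_ : complex.Re `|f 0| <= _).
  by rewrite -lecR Re_normK; exact: normr_ge0.
apply: sup_upper_bound (opnorm_has_sup f) _ _.
by exists 0 => //=; rewrite normr0.
Qed.

Lemma opnormP (f : 'L(X, Y)) x : `|f x| <= (opnorm f)%:C * `|x|.
Proof.
have [->|x0] := eqVneq x 0; first by rewrite linear0 !normr0 mulr0.
have nx0 : 0 < `|x| by rewrite normr_gt0.
rewrite -ler_pdivrMr//.
suff : complex.Re `|f (`|x|^-1 *: x)| <= opnorm f.
  rewrite -lecR Re_normK linearZ normrZ mulrC.
  by rewrite ger0_norm// invr_ge0.
apply: sup_upper_bound (opnorm_has_sup f) _ _; exists (`|x|^-1 *: x) => //=.
by rewrite normrZ ger0_norm ?invr_ge0// mulVf// gt_eqF.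
Qed.

Lemma opnorm_le (f : 'L(X, Y)) (M : R) : 0 <= M ->
  (forall x, `|f x| <= M%:C * `|x|) -> opnorm f <= M.
Proof.
move=> M0 hM; apply: ge_sup; first by have [] := opnorm_has_sup f.
move=> _ [x /= x1 <-]; rewrite -lecR Re_normK (le_trans (hM x))//.
by rewrite ler_piMr// lecR.
Qed.

Let norm (f : 'L(X, Y)) : R[i] := (opnorm f)%:C.

Let ler_normD f g : norm (f + g) <= norm f + norm g.
Proof.
rewrite /norm -rmorphD lecR; apply: opnorm_le => [|x].
  by rewrite addr_ge0// opnorm_ge0.
rewrite rmorphD mulrDl; apply: le_trans (ler_normD (f x) (g x)) _.
by rewrite lerD// opnormP.
Qed.

Let normrZ_le (a : R[i]) f : norm (a *: f) <= `|a| * norm f.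
Proof.
have ac : `|a| = (complex.Re `|a|)%:C by rewrite RRe_real ?normr_real.
have c0 : 0 <= complex.Re `|a| by rewrite -lecR -ac; exact: normr_ge0.
rewrite ac /norm -rmorphM lecR; apply: opnorm_le => [|x].
  by rewrite mulr_ge0// opnorm_ge0.
rewrite rmorphM/= -ac -mulrA.
by have := ler_wpM2l (normr_ge0 a) (opnormP f x); rewrite -normrZ.
Qed.

Let normrZ (a : R[i]) f : norm (a *: f) = `|a| * norm f.
Proof.
apply/le_anti/andP; split; first exact: normrZ_le.
have [->|a0] := eqVneq a 0.
  by rewrite normr0 mul0r scale0r /norm lecR opnorm_ge0.
have := normrZ_le a^-1 (a *: f).
by rewrite scalerA mulVf// scale1r normfV mulrC ler_pdivlMr ?normr_gt0// mulrC.
Qed.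

Let normr0_eq0 f : norm f = 0 -> f = 0.
Proof.
move=> f0; apply/val_inj/funext => x /=; apply/eqP; rewrite -normr_le0.
by have := opnormP f x; rewrite -[(_)%:C]/(norm f) f0 mul0r.
Qed.

HB.instance Definition _ :=
  Lmodule_isNormed.Build R[i] 'L(X, Y) ler_normD normrZ normr0_eq0.

End BlinLmodule.

Section BlinComp.
Context {R : realType}.

Lemma blin_id_subproof (X : normedModType R[i]) :
  (@idfun X) \in bounded_linear_pred.
Proof.
apply/asboolP; split; first by [].
by exists 1 => x; rewrite mul1r.
Qed.

Definition blin_id (X : normedModType R[i]) : 'L(X) :=
  BLin (blin_id_subproof X).

Lemma blin_comp_subproof (X Y Z : normedModType R[i])
  (g : 'L(Y, Z)) (f : 'L(X, Y)) : g \o f \in bounded_linear_pred.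
Proof.
apply/asboolP; split; first by move=> a u v /=; rewrite !linearP.
exists ((opnorm g)%:C * (opnorm f)%:C) => x /=.
rewrite (le_trans (opnormP g _))// -mulrA ler_wpM2l ?opnormP//.
by rewrite lecR opnorm_ge0.
Qed.

Definition blin_comp (X Y Z : normedModType R[i])
  (g : 'L(Y, Z)) (f : 'L(X, Y)) : 'L(X, Z) := BLin (blin_comp_subproof g f).

End BlinComp.

Notation "g '\oL' f" := (blin_comp g f)
  (at level 50, left associativity, format "g  '\oL'  f") : ring_scope.

Section MoorePenrose.
Context {R : realType}.

(* The limit is taken in the operator norm of 'L(X); it exists whenever X is
   complete. *)
Definition blin_exp (X : normedModType R[i]) (S : 'L(X)) : 'L(X) :=
  limn (series (fun k => (k`!%:R : R[i])^-1 *: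
                         iter k (blin_comp S) (blin_id X))).

(* The second disjunct is the zero space, where the operator norm of the
   identity is 0 and not 1. *)
Definition hermitian_op (X : normedModType R[i]) (S : 'L(X)) : Prop :=
  (forall t : R, `|blin_exp (('i%C * t%:C) *: S)| = 1) \/ (forall x : X, x = 0).

Definition is_mp_inverse (X Y : normedModType R[i])
    (T : 'L(X, Y)) (S : 'L(Y, X)) : Prop :=
  [/\ T = T \oL S \oL T, S = S \oL T \oL S,
      hermitian_op (S \oL T) & hermitian_op (T \oL S)].

Definition mp_invertible (X Y : normedModType R[i]) (T : 'L(X, Y)) : Prop :=
  exists S : 'L(Y, X), is_mp_inverse T S.

(* The value is 0 when T is not Moore-Penrose invertible. *)
Definition mp_inverse (X Y : normedModType R[i]) (T : 'L(X, Y)) : 'L(Y, X) :=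
  xget 0 [set S | is_mp_inverse T S].

End MoorePenrose.

Notation "T ^†" := (mp_inverse T) (at level 2, format "T ^†") : ring_scope.

Definition EP (R : realType) (X : normedModType R[i]) (T : 'L(X)) : Prop :=
  mp_invertible T /\ T \oL T^† = T^† \oL T.

(* Main.v *)
Require Import Defs.
From mathcomp Require Import all_boot all_order all_algebra.
From mathcomp Require Import complex ring.
From mathcomp Require Import all_classical all_reals all_analysis.

(* B B^† and C^† C are hermitian idempotents with the range of B and the kernel
   of C.  A hermitian idempotent P satisfies exp(i pi P) = 1 - 2P, so 1 - 2P is a
   contraction, and this forces two hermitian idempotents with the same range,
   or with the same kernel, to be equal.  Hence T T^† = B B^† and
   T^† T = C^† C, so that T is EP iff B B^† = C^† C; each factorization in the
   list is a comparison of the ranges or of the kernels of these two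
   projections. *)

Import Order.TTheory GRing.Theory Num.Theory.
Import numFieldNormedType.Exports.
Local Open Scope classical_set_scope.
Local Open Scope complex_scope.
Local Open Scope ring_scope.

(** * Convergence of real scalars acting on a complex normed space *)

Section RealScalars.
Context {R : realType} {V : normedModType R[i]}.

Lemma cvg_realZl (a : R^nat) (l : R) (v : V) :
  a @ \oo --> l -> (a n)%:C *: v @[n --> \oo] --> l%:C *: v.
Proof.
move=> al; apply/cvgrPdist_lt => e e0.
have er : e = (complex.Re e)%:C by rewrite RRe_real// gtr0_real.
have v0 : 0 <= complex.Re `|v| by rewrite -lecR Re_normK normr_ge0.
(* The added 1 keeps the denominator positive when [v = 0]. *)
have d0 : 0 < complex.Re e / (complex.Re `|v| + 1).
  by rewrite divr_gt0 ?ltr_wpDl// -ltcR -er.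
near=> n.
rewrite -scalerBl normrZ -rmorphB normc_def/= expr0n addr0 sqrtr_sqr.
rewrite -[`|v|]Re_normK -rmorphM er ltcR.
rewrite (@le_lt_trans _ _ (`|l - a n| * (complex.Re `|v| + 1)))//.
  by rewrite ler_wpM2l// lerDl.
rewrite -ltr_pdivlMr ?ltr_wpDl//.
near: n; exact: (cvgrPdist_lt _ _).1 al _ d0.
Unshelve. all: by end_near.
Qed.

End RealScalars.

(** * Exponentials of idempotents and rigidity of hermitian idempotents *)

Section ExpIdempotent.
Context {R : realType} {X : normedModType R[i]}.
Implicit Types P Q N : 'L(X).

Let expi (t : R) : R[i] := cos t +i* sin t.

Lemma blin_eqP {Y : normedModType R[i]} (f g : 'L(X, Y)) : f =1 g -> f = g.
Proof. by move=> fg; apply/val_inj/funext. Qed.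

Lemma blin_compE {Y Z : normedModType R[i]} {g : 'L(Y, Z)} {f : 'L(X, Y)}
  {h : 'L(X, Z)} : g \oL f = h -> forall x, g (f x) = h x.
Proof. by move=> <-. Qed.

(** Powers of i are real for even [k] and imaginary for odd [k], so the exponential coefficient
    splits into the cosine and sine coefficients. *)
Lemma imaginary_exp_coeff (t : R) k :
  (k`!%:R : R[i])^-1 * ('i%C * t%:C) ^+ k = cos_coeff t k +i* sin_coeff t k.
Proof.
have iX : 'i%C ^+ k = ((~~ odd k)%:R * (-1) ^+ k./2) +i*
    ((odd k)%:R * (-1) ^+ k.-1./2) :> R[i].
  rewrite -{1}(odd_double_half k) exprD -mul2n exprM sqr_i.
  have -> : (-1) ^+ k./2 = ((-1) ^+ k./2)%:C :> R[i].
    by rewrite rmorphXn rmorphN1.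
  case: (boolP (odd k)) => k2 /=; simpc; last by [].
  have -> : k.-1./2 = k./2 by rewrite -{1}(odd_double_half k) k2 doubleK.
  by [].
have -> : (k`!%:R : R[i])^-1 = ((k`!%:R)^-1)%:C by rewrite fmorphV rmorph_nat.
rewrite exprMn iX -rmorphXn /cos_coeff /sin_coeff/= -!exprnP; simpc.
by congr (_ +i* _); ring.
Qed.

Lemma iter_scaled_idem P (z : R[i]) k : P \oL P = P ->
  iter k.+1 (blin_comp (z *: P)) (blin_id X) = z ^+ k.+1 *: P.
Proof.
move=> PP; elim: k => [|k IH]; first by rewrite expr1; apply: blin_eqP.
rewrite iterS IH; apply: blin_eqP => x.
rewrite -[LHS]/(z *: P (z ^+ k.+1 *: P x)) linearZ scalerA -exprS.
by congr (_ *: _); exact: blin_compE PP x.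
Qed.

(** All positive powers of P equal P, so only the zeroth term of the series differs from a multiple
    of P, and it contributes the extra 1 - P. *)
Lemma blin_exp_idem P (t : R) : P \oL P = P ->
  blin_exp (('i%C * t%:C) *: P) = expi t *: P + (blin_id X - P).
Proof.
move=> PP; set z := 'i%C * t%:C.
(* The closed form needs at least one term: the empty sum lacks 1 - P. Hence the index [n.+1] here
   and the shift before passing to the limit. *)
have E n : series (fun k => (k`!%:R : R[i])^-1 *:
      iter k (blin_comp (z *: P)) (blin_id X)) n.+1 =
    (series (cos_coeff t) n.+1)%:C *: P +
    (series (sin_coeff t) n.+1)%:C *: ('i%C *: P) + (blin_id X - P).
  elim: n => [|n IH].
    rewrite /series/= !big_nat1 /cos_coeff /sin_coeff/= !expr0 fact0 invr1.
    rewrite !mul1r !mul0r invr1 rmorph1 rmorph0 !scale1r scale0r addr0.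
    by rewrite addrC subrK.
  rewrite seriesSr IH.
  rewrite [in RHS](seriesSr (cos_coeff t)) [in RHS](seriesSr (sin_coeff t)).
  rewrite !(rmorphD (real_complex R)) !scalerDl addrAC; congr (_ + _).
  rewrite -!addrA; congr (_ + _); rewrite [RHS]addrCA; congr (_ + _).
  rewrite iter_scaled_idem// !scalerA -scalerDl; congr (_ *: _).
  by rewrite imaginary_exp_coeff; simpc.
apply: cvg_lim; first exact: norm_hausdorff.
rewrite -cvg_shiftS.
under eq_fun do rewrite E.
apply: cvgD; last exact: cvg_cst.
have -> : expi t *: P = (cos t)%:C *: P + (sin t)%:C *: ('i%C *: P).
  rewrite scalerA -scalerDl; congr (_ *: _); rewrite /expi; simpc.
  by [].
apply: cvgD; apply: cvg_realZl.
  by rewrite (cvg_shiftS (series _)) unlock; exact: is_cvg_series_cos_coeff.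
by rewrite (cvg_shiftS (series _)) unlock; exact: is_cvg_series_sin_coeff.
Qed.

Lemma norm_blin_id : (exists x : X, x != 0) -> `|blin_id X| = 1.
Proof.
move=> [x x0]; rewrite -[LHS]/((opnorm (blin_id X))%:C) -[RHS]/(1%:C).
congr (_%:C); apply/eqP; rewrite eq_le; apply/andP; split.
  by apply: opnorm_le => // y; rewrite mul1r.
have := opnormP (blin_id X) x.
by rewrite /= -{1}[`|x|]mul1r ler_pM2r ?normr_gt0// lecR.
Qed.

Lemma hermitian_id : hermitian_op (blin_id X).
Proof.
have [x0|] := pselect (exists x : X, x != 0); last first.
  by move=> nx; right=> x; apply/eqP/negPn/negP => ?; apply: nx; exists x.
left=> t; rewrite blin_exp_idem; last exact: blin_eqP.
rewrite subrr addr0 normrZ norm_blin_id// mulr1.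
by rewrite normc_def/= cos2Dsin2 sqrtr1.
Qed.

Lemma hermitian_idem_reflection {P} : P \oL P = P -> hermitian_op P ->
  forall x, `|x - 2 *: P x| <= `|x|.
Proof.
move=> PP [hP|X0] x; last by rewrite [x]X0 linear0 scaler0 subr0.
have /(congr1 (fun c => c * `|x|)) hpi :
  (opnorm (blin_exp (('i%C * pi%:C) *: P)))%:C = 1 := hP pi.
have := opnormP (blin_exp (('i%C * pi%:C) *: P)) x.
rewrite hpi mul1r blin_exp_idem// /expi cospi sinpi complexr0 rmorphN1.
have -> : (-1 *: P + (blin_id X - P)) x = -1 *: P x + (x - P x) by [].
by rewrite scaleN1r addrCA -opprD -mulr2n -scaler_nat.
Qed.

(** Since N has square zero, (1 + N)^k = 1 + kN is a contraction for every k. Thus k |N x| is at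
    most 2 |x| for all k, which forces N x = 0. *)
Lemma contractive_nilpotent_eq0 N : (forall x, N (N x) = 0) ->
  (forall x, `|x + N x| <= `|x|) -> N = 0.
Proof.
move=> NN hN.
have pow k x : `|x + N x *+ k| <= `|x|.
  elim: k => [|k IH]; first by rewrite mulr0n addr0.
  have := hN (x + N x *+ k).
  rewrite linearD linearMn/= NN mul0rn addr0 -addrA -mulrSr => /le_trans; exact.
apply: blin_eqP => x; apply/eqP; rewrite -normr_eq0; apply/negPn/negP => Nx0.
set a := complex.Re `|N x|; set b := complex.Re `|x|.
have a0 : 0 < a by rewrite -ltcR Re_normK lt_def Nx0 normr_ge0.
have bound k : a *+ k <= b + b.
  rewrite -lecR rmorphMn rmorphD/= !Re_normK -normrMn.
  by rewrite -[N x *+ k](addKr x) (le_trans (ler_normD _ _))// normrN lerD.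
(* An integer exceeding (b + b) / a contradicts the bound. *)
have := bound (Num.bound ((b + b) / a)).
apply/negP; rewrite -ltNge -mulr_natl -ltr_pdivrMr//.
by rewrite archi_boundP// divr_ge0 ?(ltW a0)//; exact: bound 0%N.
Qed.

(* The operator n = Q - P has square zero, while 1 + 2n is the product
   of the reflections 1 - 2P and 1 - 2Q, hence a contraction. *)
Lemma hermitian_idem_eq_range {P Q} : P \oL P = P -> Q \oL Q = Q ->
  hermitian_op P -> hermitian_op Q -> P \oL Q = Q -> Q \oL P = P -> P = Q.
Proof.
move=> PP QQ hP hQ PQ QP.
have E : (2 : R[i]) *: (Q - P) = 0.
  have e x : ((2 : R[i]) *: (Q - P)) x = 2 *: (Q x - P x) by [].
  apply: contractive_nilpotent_eq0 => x; rewrite !e.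
    rewrite !linearZ !linearB/= (blin_compE PP) (blin_compE QQ).
    by rewrite (blin_compE PQ) (blin_compE QP) -scalerDr -opprD subrr !scaler0.
  have := hermitian_idem_reflection QQ hQ x; apply: le_trans.
  have := hermitian_idem_reflection PP hP (x - 2 *: Q x); apply: le_trans.
  have -> : P (x - 2 *: Q x) = P x - 2 *: Q x.
    by rewrite linearB linearZ/= (blin_compE PQ).
  rewrite !scalerBr opprB [2 *: (2 *: _)]scaler_nat mulr2n.
  by rewrite !addrA subrK.
apply/esym/eqP; rewrite -subr_eq0; move/eqP: E.
by rewrite scaler_eq0 pnatr_eq0/=.
Qed.

(** Here PQ = P turns (1 - 2P)(1 - 2Q) into 1 + 2(P - Q), and P - Q again has square zero. *)
Lemma hermitian_idem_eq_ker {P Q} : P \oL P = P -> Q \oL Q = Q ->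
  hermitian_op P -> hermitian_op Q -> P \oL Q = P -> Q \oL P = Q -> P = Q.
Proof.
move=> PP QQ hP hQ PQ QP.
have E : (2 : R[i]) *: (P - Q) = 0.
  have e x : ((2 : R[i]) *: (P - Q)) x = 2 *: (P x - Q x) by [].
  apply: contractive_nilpotent_eq0 => x; rewrite !e.
    rewrite !linearZ !linearB/= (blin_compE PP) (blin_compE QQ).
    by rewrite (blin_compE PQ) (blin_compE QP) !(subrr, scaler0, addr0).
  have := hermitian_idem_reflection QQ hQ x; apply: le_trans.
  have := hermitian_idem_reflection PP hP (x - 2 *: Q x); apply: le_trans.
  have -> : P (x - 2 *: Q x) = - P x.
    rewrite linearB linearZ/= (blin_compE PQ) scaler_nat mulr2n opprD addrA.
    by rewrite subrr sub0r.
  by rewrite scalerN opprK scalerBr addrCA addrC.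
apply/eqP; rewrite -subr_eq0; move/eqP: E.
by rewrite scaler_eq0 pnatr_eq0/=.
Qed.

End ExpIdempotent.

Section MoorePenrose.
Context {R : realType} {X Y : normedModType R[i]}.

Lemma mp_inverseP (A : 'L(X, Y)) : mp_invertible A -> is_mp_inverse A A^†.
Proof. exact: (@xgetPex _ 0 [set S | is_mp_inverse A S]). Qed.

End MoorePenrose.

(** * Moore-Penrose inverses of the two factors of T *)

Section FullRankFactorization.
Context {R : realType} {X Y : normedModType R[i]}.
Context {T : 'L(X)} {C : 'L(X, Y)} {B : 'L(Y, X)}.
Hypothesis C_surj : set_surj [set: X] [set: Y] C.
Hypothesis B_inj : injective B.
Hypothesis TBC : T = B \oL C.
Hypothesis T_mp : mp_invertible T.

Let surjC y : exists x, C x = y.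
Proof. by have [x _ <-] := C_surj y I; exists x. Qed.

Let TE x : T x = B (C x). Proof. by rewrite TBC. Qed.

(** In B C T^† B C = B C, the left B cancels by injectivity and the right C by surjectivity. *)
Lemma factor_mpK y : C (T^† (B y)) = y.
Proof.
have [TST _ _ _] := mp_inverseP _ T_mp.
have [x <-] := surjC y; apply: B_inj; rewrite -!TE.
exact: (blin_compE (esym TST)).
Qed.

(** The witness C T^† is a left inverse of B, and B (C T^†) = T T^† is hermitian. *)
Lemma is_mp_inverse_inj_factor : is_mp_inverse B B^†.
Proof.
have [_ _ _ hTS] := mp_inverseP _ T_mp.
apply: mp_inverseP; exists (C \oL T^†); split.
- by apply: blin_eqP => y /=; rewrite factor_mpK.
- by apply: blin_eqP => x /=; rewrite factor_mpK.
- have -> : C \oL T^† \oL B = blin_id Y by apply: blin_eqP; exact: factor_mpK.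
  exact: hermitian_id.
- have -> // : B \oL (C \oL T^†) = T \oL T^†.
  by apply: blin_eqP => x /=; rewrite TE.
Qed.

(** Dually, T^† B is a right inverse of C, and (T^† B) C = T^† T is hermitian. *)
Lemma is_mp_inverse_surj_factor : is_mp_inverse C C^†.
Proof.
have [_ _ hST _] := mp_inverseP _ T_mp.
apply: mp_inverseP; exists (T^† \oL B); split.
- by apply: blin_eqP => x /=; rewrite factor_mpK.
- by apply: blin_eqP => y /=; rewrite factor_mpK.
- have -> // : T^† \oL B \oL C = T^† \oL T.
  by apply: blin_eqP => x /=; rewrite TE.
- have -> : C \oL (T^† \oL B) = blin_id Y by apply: blin_eqP; exact: factor_mpK.
  exact: hermitian_id.
Qed.

Lemma mp_inj_factorK y : B^† (B y) = y.
Proof.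
have [BSB _ _ _] := is_mp_inverse_inj_factor.
by apply: B_inj; exact: (blin_compE (esym BSB)).
Qed.

Lemma mp_surj_factorK y : C (C^† y) = y.
Proof.
have [CSC _ _ _] := is_mp_inverse_surj_factor.
by have [x <-] := surjC y; exact: (blin_compE (esym CSC)).
Qed.

(** [B^†] is a chosen inverse, not identified with C T^†; the two projections agree because both are
    hermitian with the range of B. *)
Lemma mp_range_projection : T \oL T^† = B \oL B^†.
Proof.
have [TST _ _ hTS] := mp_inverseP _ T_mp.
have [_ _ _ hBS] := is_mp_inverse_inj_factor.
apply: hermitian_idem_eq_range => //; apply: blin_eqP => x /=;
  by rewrite ?TE ?mp_inj_factorK ?factor_mpK.
Qed.

Lemma mp_kernel_projection : T^† \oL T = C^† \oL C.
Proof.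
have [TST _ hST _] := mp_inverseP _ T_mp.
have [_ _ hSC _] := is_mp_inverse_surj_factor.
apply: hermitian_idem_eq_ker => //; apply: blin_eqP => x /=;
  by rewrite ?TE ?mp_surj_factorK ?factor_mpK.
Qed.

Lemma EP_factorP : EP T <-> B \oL B^† = C^† \oL C.
Proof.
by rewrite -mp_range_projection -mp_kernel_projection; split=> [[]|].
Qed.

(** * Factorizations as inclusions between ranges and kernels of [P] and [Q] *)

Let P := B \oL B^†.
Let Q := C^† \oL C.

Let EP_of_eq_range : P \oL Q = Q -> Q \oL P = P -> EP T.
Proof.
move=> PQ QP; apply/EP_factorP.
have [_ _ _ hP] := is_mp_inverse_inj_factor.
have [_ _ hQ _] := is_mp_inverse_surj_factor.
apply: hermitian_idem_eq_range => //; apply: blin_eqP => x /=;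
  by rewrite ?mp_inj_factorK ?mp_surj_factorK.
Qed.

Let EP_of_eq_ker : P \oL Q = P -> Q \oL P = Q -> EP T.
Proof.
move=> PQ QP; apply/EP_factorP.
have [_ _ _ hP] := is_mp_inverse_inj_factor.
have [_ _ hQ _] := is_mp_inverse_surj_factor.
apply: hermitian_idem_eq_ker => //; apply: blin_eqP => x /=;
  by rewrite ?mp_inj_factorK ?mp_surj_factorK.
Qed.

(** The factorization puts the kernel of B^†, which is that of P, inside the kernel of C, which is
    that of Q. *)
Let QP_eq_Q {U : 'L(Y)} : C = U \oL B^† -> Q \oL P = Q.
Proof.
move=> CU; apply: blin_eqP => x /=; congr (C^† _).
by rewrite -!(blin_compE (esym CU)) mp_inj_factorK.
Qed.

Let PQ_eq_P {U : 'L(Y)} : B^† = U \oL C -> P \oL Q = P.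
Proof.
move=> BU; apply: blin_eqP => x /=; congr (B _).
by rewrite -!(blin_compE (esym BU)) mp_surj_factorK.
Qed.

(** The factorization puts the range of B, which is that of P, inside the range of C^†, on which Q
    is the identity. *)
Let QP_eq_P {W : 'L(Y)} : B = C^† \oL W -> Q \oL P = P.
Proof.
move=> BW; apply: blin_eqP => x /=.
by rewrite -!(blin_compE (esym BW)) mp_surj_factorK.
Qed.

Let PQ_eq_Q {W : 'L(Y)} : C^† = B \oL W -> P \oL Q = Q.
Proof.
move=> CW; apply: blin_eqP => x /=.
by rewrite -!(blin_compE (esym CW)) mp_inj_factorK.
Qed.

(** Injectivity of U upgrades the inclusion of kernels to an equality. *)
Lemma EP_of_C_inj {U : 'L(Y)} : injective U -> C = U \oL B^† -> EP T.
Proof.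
move=> U_inj CU; apply: EP_of_eq_ker; last exact: QP_eq_Q CU.
apply: blin_eqP => x /=; congr (B _); apply: U_inj.
by rewrite !(blin_compE (esym CU)) mp_surj_factorK.
Qed.

Lemma EP_of_Bmp_inj {U : 'L(Y)} : injective U -> B^† = U \oL C -> EP T.
Proof.
move=> U_inj BU; apply: EP_of_eq_ker; first exact: PQ_eq_P BU.
apply: blin_eqP => x /=; congr (C^† _); apply: U_inj.
by rewrite !(blin_compE (esym BU)) mp_inj_factorK.
Qed.

(** Surjectivity of W upgrades the inclusion of ranges to an equality. *)
Lemma EP_of_B_surj {W : 'L(Y)} :
  set_surj [set: Y] [set: Y] W -> B = C^† \oL W -> EP T.
Proof.
move=> W_surj BW; apply: EP_of_eq_range; last exact: QP_eq_P BW.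
apply: blin_eqP => x /=; have [z _ <-] := W_surj (C x) I.
by rewrite !(blin_compE (esym BW)) mp_inj_factorK.
Qed.

Lemma EP_of_Cmp_surj {W : 'L(Y)} :
  set_surj [set: Y] [set: Y] W -> C^† = B \oL W -> EP T.
Proof.
move=> W_surj CW; apply: EP_of_eq_range; first exact: PQ_eq_Q CW.
apply: blin_eqP => x /=; have [z _ <-] := W_surj (B^† x) I.
by rewrite !(blin_compE (esym CW)) mp_surj_factorK.
Qed.

Lemma EP_of_C_Bmp {U U' : 'L(Y)} : C = U \oL B^† -> B^† = U' \oL C -> EP T.
Proof. by move=> CU BU; exact: EP_of_eq_ker (PQ_eq_P BU) (QP_eq_Q CU). Qed.

Lemma EP_of_B_Cmp {W W' : 'L(Y)} : B = C^† \oL W -> C^† = B \oL W' -> EP T.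
Proof. by move=> BW CW; exact: EP_of_eq_range (PQ_eq_Q CW) (QP_eq_P BW). Qed.

(** One range inclusion and one kernel inclusion evaluate the same product QP both as P and as Q. *)
Lemma EP_of_B_C {U W : 'L(Y)} : B = C^† \oL W -> C = U \oL B^† -> EP T.
Proof.
by move=> BW CU; apply/EP_factorP; rewrite -/P -(QP_eq_P BW) (QP_eq_Q CU).
Qed.

Lemma EP_of_Cmp_Bmp {U W : 'L(Y)} : C^† = B \oL W -> B^† = U \oL C -> EP T.
Proof.
by move=> CW BU; apply/EP_factorP; rewrite -/P -(PQ_eq_P BU) (PQ_eq_Q CW).
Qed.

Lemma EP_factor_relations : EP T -> exists V V' : 'L(Y),
  [/\ bijective V /\ bijective V', C = V \oL B^†, B = C^† \oL V,
      B^† = V' \oL C & C^† = B \oL V'].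
Proof.
move=> /EP_factorP/blin_compE/= PQ.
have E x : B (B^† x) = C^† (C x) by exact: PQ.
(* Once B B^† = C^† C, these two operators are mutually inverse, and this one pair provides all four
   factorizations. *)
exists (C \oL B), (B^† \oL C^†).
have VK : cancel (C \oL B) (B^† \oL C^†).
  by move=> y /=; rewrite -E !mp_inj_factorK.
have V'K : cancel (B^† \oL C^†) (C \oL B).
  by move=> y /=; rewrite E !mp_surj_factorK.
split; first by split; [exists (B^† \oL C^†) | exists (C \oL B)].
- by apply: blin_eqP => x /=; rewrite E mp_surj_factorK.
- by apply: blin_eqP => x /=; rewrite -E mp_inj_factorK.
- by apply: blin_eqP => x /=; rewrite -E mp_inj_factorK.
- by apply: blin_eqP => x /=; rewrite E mp_surj_factorK.
Qed.

End FullRankFactorization.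

(** * The cycle of implications between the eleven conditions *)

Theorem theorem3p5 (R : realType) (X Y : completeNormedModType R[i])
    (T : 'L(X)) (C : 'L(X, Y)) (B : 'L(Y, X)) :
  set_surj [set: X] [set: Y] C -> injective B -> T = B \oL C ->
  mp_invertible T ->
  [<-> (* i *) EP T;
       (* ii *) exists U : 'L(Y), bijective U /\ C = U \oL B^†;
       (* iii *) exists U1 : 'L(Y), injective U1 /\ C = U1 \oL B^†;
       (* iv *) exists U2 U3 : 'L(Y), C = U2 \oL B^† /\ B^† = U3 \oL C;
       (* v *) exists W : 'L(Y), bijective W /\ B = C^† \oL W;
       (* vi *) exists W1 : 'L(Y),
                  set_surj [set: Y] [set: Y] W1 /\ B = C^† \oL W1;
       (* vii *) exists W2 W3 : 'L(Y), B = C^† \oL W2 /\ C^† = B \oL W3;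
       (* viii *) exists H1 H2 : 'L(Y), B = C^† \oL H2 /\ C = H1 \oL B^†;
       (* ix *) exists K1 K2 : 'L(Y), C^† = B \oL K2 /\ B^† = K1 \oL C;
       (* x *) exists S1 : 'L(Y), injective S1 /\ B^† = S1 \oL C;
       (* xi *) exists S2 : 'L(Y),
                  set_surj [set: Y] [set: Y] S2 /\ C^† = B \oL S2].
Proof.
move=> C_surj B_inj TBC T_mp.
have rel := EP_factor_relations C_surj B_inj TBC T_mp.
have surj (W : 'L(Y)) : bijective W -> set_surj [set: Y] [set: Y] W.
  by move=> [W' _ W'K] y _; exists (W' y).
tfae.
- by move=> /rel[V [_ [[V_bij _] CV _ _ _]]]; exists V.
- by move=> [U [/bij_inj U_inj CU]]; exists U.
(* From here on, an implication that is not immediate first recovers EP and then reads the next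
   witnesses off [rel]. *)
- move=> [U [U_inj CU]].
  have /rel[V [V' [_ CV _ BV' _]]] :=
    EP_of_C_inj C_surj B_inj TBC T_mp U_inj CU.
  by exists V, V'.
- move=> [U2 [U3 [CU BU]]].
  have /rel[V [_ [[V_bij _] _ BV _ _]]] :=
    EP_of_C_Bmp C_surj B_inj TBC T_mp CU BU.
  by exists V.
- by move=> [W [/surj W_surj BW]]; exists W.
- move=> [W [W_surj BW]].
  have /rel[V [V' [_ _ BV _ CV']]] :=
    EP_of_B_surj C_surj B_inj TBC T_mp W_surj BW.
  by exists V, V'.
- move=> [W2 [W3 [BW CW]]].
  have /rel[V [_ [_ CV BV _ _]]] := EP_of_B_Cmp C_surj B_inj TBC T_mp BW CW.
  by exists V, V.
- move=> [H1 [H2 [BH CH]]].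
  have /rel[_ [V' [_ _ _ BV' CV']]] := EP_of_B_C C_surj B_inj TBC T_mp BH CH.
  by exists V', V'.
- move=> [K1 [K2 [CK BK]]].
  have /rel[_ [V' [[_ /bij_inj V'_inj] _ _ BV' _]]] :=
    EP_of_Cmp_Bmp C_surj B_inj TBC T_mp CK BK.
  by exists V'.
- move=> [S1 [S_inj BS]].
  have /rel[_ [V' [[_ /surj V'_surj] _ _ _ CV']]] :=
    EP_of_Bmp_inj C_surj B_inj TBC T_mp S_inj BS.
  by exists V'.
- move=> [S2 [S_surj CS]].
  by have := EP_of_Cmp_surj C_surj B_inj TBC T_mp S_surj CS.
Qed.
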